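(* Let $Z^*$ be the optimal value of the problem SCUC-ACOPF and let $$Z^{\mathrm{UB}}:=\sum_{t\in\mathcal T}\ \max_{p_t,q_t,u_t,\mu_t,\omega_t}\Big\{C^{\mathrm{UB}}_t(p_t,q_t,u_t)\ :\ (p_t,q_t,\mu_t,\omega_t)\in\mathcal X^{\mathrm{soc}}_t,\ (p_{jt},q_{jt},u^{\mathrm{on}}_{jt})\in\mathcal Y^{\mathrm{uc}}_{jt}\ \ \forall j\in\mathcal J^{\mathrm{sd}}\Big\},$$ where $$C^{\mathrm{UB}}_t(p,q,u):=\sum_{j\in\mathcal J^{\mathrm{cs}}}R^{\mathrm{pow}}_{jt}(p)-\sum_{j\in\mathcal J^{\mathrm{pr}}}C^{\mathrm{pow}}_{jt}(p)-\sum_{j\in\mathcal J^{\mathrm{ac}}}C^{\mathrm{ac}}_{jt}(p,q)-\sum_{i\in\mathcal I}C^{\mathrm{bal}}_{it}(p,q)-\sum_{j\in\mathcal J^{\mathrm{sd}}}c^{\mathrm{on}}_{jt}u^{\mathrm{on}}_{jt}-C^{\mathrm{res}}_t(p,q).$$ Then $Z^*\le Z^{\mathrm{UB}}$.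
   Context: **Index sets.** $\mathcal T=\{1,\dots,T\}$ are time periods with lengths $d_t>0$. $\mathcal J^{\mathrm{pr}},\mathcal J^{\mathrm{cs}}$ are disjoint finite sets of producing and consuming devices, $\mathcal J^{\mathrm{sd}}=\mathcal J^{\mathrm{pr}}\cup\mathcal J^{\mathrm{cs}}$; $\mathcal I$ is the finite set of buses; $\mathcal J^{\mathrm{ac}},\mathcal J^{\mathrm{dc}}$ are the finite sets of AC and DC branches, $\mathcal J^{\mathrm{br}}$ their disjoint union, branch $j$ going from bus $i_j$ to bus $i'_j$; $\mathcal J^{\mathrm{sh}}$ is the finite set of shunts; each device or shunt $j$ sits at bus $i_j$; $\mathcal R$ is a finite set of real reserve products. $[x]^+=\max\{x,0\}$. A subscript $j$ or $t$ on $p,q,u$ denotes the sub-collection of variables with that index. **Device constraints** ($j\in\mathcal J^{\mathrm{sd}}$, $t\in\mathcal T$; $u^{\mathrm{on}}_{j0}\in\{0,1\}$ and $p^{\mathrm{tot}}_{j0}$ are data). Data: $p^{\mathrm{supc}}_{jtt'},p^{\mathrm{sdpc}}_{jtt'}\ge0$, $\mathcal T^{\mathrm{supc}}_{jt}=\{t'\in\mathcal T:t'>t,\ p^{\mathrm{supc}}_{jtt'}>0\}$, $\mathcal T^{\mathrm{sdpc}}_{jt}=\{t'\in\mathcal T:t'\le t,\ p^{\mathrm{sdpc}}_{jtt'}>0\}$; polyhedra $\mathcal X^{\mathrm u}_j$ (linear commitment rules) and $\mathcal X^{\mathrm p}_{jt}$ (linear power/reserve bounds); reals $q^{\max}_{jt},q^{\min}_{jt},\beta^{\max}_j,\beta^{\min}_j$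 and ramp rates $p^{\mathrm{ru}}_j,p^{\mathrm{rd}}_j,p^{\mathrm{ru,su}}_j,p^{\mathrm{rd,sd}}_j$. (U) $u^{\mathrm{on}}_{jt}-u^{\mathrm{on}}_{j,t-1}=u^{\mathrm{su}}_{jt}-u^{\mathrm{sd}}_{jt}$; $u^{\mathrm{su}}_{jt}+u^{\mathrm{sd}}_{jt}\le1$; $\{u^{\mathrm{on}}_{jt},u^{\mathrm{su}}_{jt},u^{\mathrm{sd}}_{jt}\}_{t\in\mathcal T}\in\mathcal X^{\mathrm u}_j$; $u^{\mathrm{on}}_{jt},u^{\mathrm{su}}_{jt},u^{\mathrm{sd}}_{jt}\in\{0,1\}$. (P1) $p^{\mathrm{tot}}_{jt}=p^{\mathrm{on}}_{jt}+p^{\mathrm{su}}_{jt}+p^{\mathrm{sd}}_{jt}$. (P2) $p^{\mathrm{su}}_{jt}=\sum_{t'\in\mathcal T^{\mathrm{supc}}_{jt}}p^{\mathrm{supc}}_{jtt'}u^{\mathrm{su}}_{jt'}$, $p^{\mathrm{sd}}_{jt}=\sum_{t'\in\mathcal T^{\mathrm{sdpc}}_{jt}}p^{\mathrm{sdpc}}_{jtt'}u^{\mathrm{sd}}_{jt'}$. (P3) $(u^{\mathrm{on}}_{jt},p^{\mathrm{tot}}_{jt},p^{\mathrm{on}}_{jt},\{p^{\mathrm{res}}_{jtr}\}_{r\in\mathcal R})\in\mathcal X^{\mathrm p}_{jt}$. (P4) $p^{\mathrm{tot}}_{jt},p^{\mathrm{on}}_{jt},p^{\mathrm{res}}_{jtr}\ge0$.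 (Q) With $\sigma_{jt}:=u^{\mathrm{on}}_{jt}+\sum_{t'\in\mathcal T^{\mathrm{supc}}_{jt}}u^{\mathrm{su}}_{jt'}+\sum_{t'\in\mathcal T^{\mathrm{sdpc}}_{jt}}u^{\mathrm{sd}}_{jt'}$: $q^{\mathrm{tot}}_{jt}\le q^{\max}_{jt}\sigma_{jt}+\beta^{\max}_jp^{\mathrm{tot}}_{jt}-q^{\mathrm{res}}_{jta}$ and $q^{\mathrm{tot}}_{jt}\ge q^{\min}_{jt}\sigma_{jt}+\beta^{\min}_jp^{\mathrm{tot}}_{jt}+q^{\mathrm{res}}_{jtb}$, where $(a,b)=(\uparrow,\downarrow)$ if $j\in\mathcal J^{\mathrm{pr}}$ and $(a,b)=(\downarrow,\uparrow)$ if $j\in\mathcal J^{\mathrm{cs}}$; $q^{\mathrm{res}}_{jt\uparrow},q^{\mathrm{res}}_{jt\downarrow}\ge0$. (R) $-d_t\big(p^{\mathrm{rd}}_ju^{\mathrm{on}}_{jt}+p^{\mathrm{rd,sd}}_j(1-u^{\mathrm{on}}_{jt})\big)\le p^{\mathrm{tot}}_{jt}-p^{\mathrm{tot}}_{j,t-1}\le d_t\big(p^{\mathrm{ru}}_j(u^{\mathrm{on}}_{jt}-u^{\mathrm{su}}_{jt})+p^{\mathrm{ru,su}}_j(u^{\mathrm{su}}_{jt}-u^{\mathrm{on}}_{jt}+1)\big)$. **Network constraints** ($t\in\mathcal T$; $g,b$ with indices are real data). (F1) For $j\in\mathcal J^{\mathrm{ac}}$: $\Delta_{jt}=\theta_{i_jt}-\theta_{i'_jt}-\phi_{jt}$;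 $p^{\mathrm{fr}}_{jt}=v_{i_jt}\big(g_{i_jj}v_{i_jt}/\tau_{jt}^2+\frac{v_{i'_jt}}{\tau_{jt}}(-g_j\cos\Delta_{jt}-b_j\sin\Delta_{jt})\big)$; $p^{\mathrm{to}}_{jt}=v_{i'_jt}\big(g_{i'_jj}v_{i'_jt}+\frac{v_{i_jt}}{\tau_{jt}}(-g_j\cos\Delta_{jt}+b_j\sin\Delta_{jt})\big)$; $q^{\mathrm{fr}}_{jt}=v_{i_jt}\big(-b_{i_jj}v_{i_jt}/\tau_{jt}^2+\frac{v_{i'_jt}}{\tau_{jt}}(b_j\cos\Delta_{jt}-g_j\sin\Delta_{jt})\big)$; $q^{\mathrm{to}}_{jt}=v_{i'_jt}\big(-b_{i'_jj}v_{i'_jt}+\frac{v_{i_jt}}{\tau_{jt}}(b_j\cos\Delta_{jt}+g_j\sin\Delta_{jt})\big)$. (F2) $p^{\mathrm{fr}}_{jt}+p^{\mathrm{to}}_{jt}=0$ for $j\in\mathcal J^{\mathrm{dc}}$; $p^{\mathrm{sh}}_{jt}=g^{\mathrm{sh}}_ju^{\mathrm{sh}}_{jt}v_{i_jt}^2$ and $q^{\mathrm{sh}}_{jt}=-b^{\mathrm{sh}}_ju^{\mathrm{sh}}_{jt}v_{i_jt}^2$ for $j\in\mathcal J^{\mathrm{sh}}$. (F3) $v_{it}\in[v^{\min}_i,v^{\max}_i]$ for $i\in\mathcal I$; $\phi_{jt}\in[\phi^{\min}_j,\phi^{\max}_j]$, $\tau_{jt}\in[\tau^{\min}_j,\tau^{\max}_j]$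 for $j\in\mathcal J^{\mathrm{ac}}$; and (DC) $p^{\mathrm{fr}}_{jt},p^{\mathrm{to}}_{jt}\in[-p^{\max}_j,p^{\max}_j]$, $q^{\mathrm{fr}}_{jt}\in[q^{\mathrm{fr,min}}_j,q^{\mathrm{fr,max}}_j]$, $q^{\mathrm{to}}_{jt}\in[q^{\mathrm{to,min}}_j,q^{\mathrm{to,max}}_j]$ for $j\in\mathcal J^{\mathrm{dc}}$; the voltage and tap bounds are positive. (F4) $u^{\mathrm{sh}}_{jt}\in[u^{\mathrm{sh,min}}_j,u^{\mathrm{sh,max}}_j]\cap\mathbb Z_+$ for $j\in\mathcal J^{\mathrm{sh}}$, with integral bounds. **Objective terms.** $C^{\mathrm{uc}}_j(u)=\sum_{t}\big(c^{\mathrm{on}}_{jt}u^{\mathrm{on}}_{jt}+c^{\mathrm{su}}_ju^{\mathrm{su}}_{jt}+c^{\mathrm{sd}}_ju^{\mathrm{sd}}_{jt}-\sum_{t'<t}c^{\mathrm{dd}}_{jtt'}[u^{\mathrm{su}}_{jt}+u^{\mathrm{on}}_{jt'}-1]^+\big)$ with $c^{\mathrm{su}}_j,c^{\mathrm{sd}}_j,c^{\mathrm{dd}}_{jtt'}\ge0$. $C^{\mathrm e}_j(p)=c^{\mathrm e}\big(\sum_{W\in\mathcal W^{\mathrm{en,min}}_j}[e^{\min}_j(W)-\sum_{t\in W}d_tp^{\mathrm{tot}}_{jt}]^++\sum_{W\in\mathcal W^{\mathrm{en,max}}_j}[-e^{\max}_j(W)+\sum_{t\in W}d_tp^{\mathrm{tot}}_{jt}]^+\big)$,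 $c^{\mathrm e}\ge0$, where $\mathcal W^{\mathrm{en,min}}_j,\mathcal W^{\mathrm{en,max}}_j$ are finite families of subsets of $\mathcal T$. $C^{\mathrm{pow}}_{jt}$ ($j\in\mathcal J^{\mathrm{pr}}$) is a convex and $R^{\mathrm{pow}}_{jt}$ ($j\in\mathcal J^{\mathrm{cs}}$) a concave piecewise linear function of $p^{\mathrm{tot}}_{jt}$. $C^{\mathrm{res}}_t(p,q)=d_t\Big(\sum_{j,r}c^{\mathrm{res,p}}_{jtr}p^{\mathrm{res}}_{jtr}+\sum_{R'\subset\mathcal R}c^{\mathrm{res}}_{R'}\sum_{N\in\mathcal N^{\mathrm p}}\big[p^{\mathrm{res,min}}_t(p;R',N)-\sum_{r\in R'}\sum_{j\in N}p^{\mathrm{res}}_{jtr}\big]^++\sum_{r\in\{\uparrow,\downarrow\}}\big(\sum_jc^{\mathrm{res,q}}_{jtr}q^{\mathrm{res}}_{jtr}+c^{\mathrm{res}}_r\sum_{N\in\mathcal N^{\mathrm q}}[q^{\mathrm{res,min}}_t(q;r,N)-\sum_{j\in N}q^{\mathrm{res}}_{jtr}]^+\big)\Big)$, where $\mathcal N^{\mathrm p},\mathcal N^{\mathrm q}$ are finite families of subsets of $\mathcal J^{\mathrm{sd}}$, the coefficients $c^{\mathrm{res}}$ are nonnegative, and each requirement function is a constant, or a nonnegative multiple of the sum or of the maximum over $j\in N$ of the period-$t$ injections. $C^{\mathrm{ac}}_{jt}(p,q)=c^{\mathrm s}d_t\big[\max\{\|(p^{\mathrm{fr}}_{jt},q^{\mathrm{fr}}_{jt})\|_2,\|(p^{\mathrm{to}}_{jt},q^{\mathrm{to}}_{jt})\|_2\}-s^{\max}_j\big]^+$,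 $c^{\mathrm s}\ge0$. $C^{\mathrm{bal}}_{it}(p,q)=d_t(c^{\mathrm p}|B_{it}(p)|+c^{\mathrm q}|B_{it}(q)|)$, $c^{\mathrm p},c^{\mathrm q}\ge0$, where for $x\in\{p,q\}$, $B_{it}(x)=\sum_{j\in\mathcal J^{\mathrm{pr}},i_j=i}x^{\mathrm{tot}}_{jt}-\sum_{j\in\mathcal J^{\mathrm{cs}},i_j=i}x^{\mathrm{tot}}_{jt}-\sum_{j\in\mathcal J^{\mathrm{sh}},i_j=i}x^{\mathrm{sh}}_{jt}-\sum_{j\in\mathcal J^{\mathrm{br}},i_j=i}x^{\mathrm{fr}}_{jt}-\sum_{j\in\mathcal J^{\mathrm{br}},i'_j=i}x^{\mathrm{to}}_{jt}$. $C^{\mathrm{ctg}}_t=\frac1K\sum_{k=1}^KC^{\mathrm{ctg}}_{kt}+\max_kC^{\mathrm{ctg}}_{kt}$, $C^{\mathrm{ctg}}_{kt}(p,q)=c^{\mathrm s}d_t\sum_{j\in\mathcal J^{\mathrm{ac}},j\ne j_k}\big[\|(f_{kjt}(p),\max\{|q^{\mathrm{fr}}_{jt}|,|q^{\mathrm{to}}_{jt}|\})\|_2-s^{\mathrm{max,ctg}}_j\big]^+$, $f_{kjt}(p)=\sum_{i\in\mathcal I}F_{kji}\big(p^{\mathrm{inj}}_{it}(p)-\frac1{|\mathcal I|}\sum_{i'\in\mathcal I}p^{\mathrm{inj}}_{i't}(p)\big)$ with real data $F_{kji}$, $j_k\in\mathcal J^{\mathrm{ac}}$, and $p^{\mathrm{inj}}_{it}(p)$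 equal to $B_{it}(p)$ with the sums over $\mathcal J^{\mathrm{br}}$ restricted to $\mathcal J^{\mathrm{dc}}$. $R^{\mathrm T}_t=-C^{\mathrm{res}}_t-C^{\mathrm{ctg}}_t-\sum_{j\in\mathcal J^{\mathrm{ac}}}C^{\mathrm{ac}}_{jt}-\sum_{i\in\mathcal I}C^{\mathrm{bal}}_{it}$. $R^{\mathrm J}_j=-C^{\mathrm{uc}}_j-C^{\mathrm e}_j+\sum_tR^{\mathrm{pow}}_{jt}$ if $j\in\mathcal J^{\mathrm{cs}}$, and $R^{\mathrm J}_j=-C^{\mathrm{uc}}_j-C^{\mathrm e}_j-\sum_tC^{\mathrm{pow}}_{jt}$ if $j\in\mathcal J^{\mathrm{pr}}$. **SCUC-ACOPF**: $Z^*$ is the maximum of $\sum_tR^{\mathrm T}_t(p,q)+\sum_{j\in\mathcal J^{\mathrm{sd}}}R^{\mathrm J}_j(p,u)$ over $(p,q,u,v,\Delta,\theta,\tau,\phi)$ subject to (U), (P1)–(P4), (Q), (R), (F1)–(F4). **Standing assumption.** (1) $c^{\mathrm{su}}_j\ge\sum_{t'<t}c^{\mathrm{dd}}_{jtt'}$ for all $j,t$. (2) For each $j\in\mathcal J^{\mathrm{sd}}$, every $u_j$ satisfying (U) satisfies (S): $u^{\mathrm{on}}_{jt}+\sum_{t'\in\mathcal T^{\mathrm{supc}}_{jt}}u^{\mathrm{su}}_{jt'}\le1$ and $u^{\mathrm{on}}_{jt}+\sum_{t'\in\mathcal T^{\mathrm{sdpc}}_{jt}}u^{\mathrm{sd}}_{jt'}\le1$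 for all $t$. (3) The sets $\mathcal X^{\mathrm p}_{jt}$ are closed, convex, bounded and polyhedral. (4) SCUC-ACOPF is feasible with $Z^*\ge0$. **Relaxed sets.** $\mathcal Y^{\mathrm{uc}}_{jt}$ is the set of $(p_{jt},q_{jt},u^{\mathrm{on}}_{jt})$ with $u^{\mathrm{on}}_{jt}\ge0$ for which there exist $(u^{\mathrm{su}}_j,u^{\mathrm{sd}}_j)\in[0,1]^{2T}$ satisfying at $(j,t)$ the constraints (P1), (P3), (P4), (Q), (S) and $0\le p^{\mathrm{su}}_{jt}\le\sum_{t'\in\mathcal T^{\mathrm{supc}}_{jt}}p^{\mathrm{supc}}_{jtt'}u^{\mathrm{su}}_{jt'}$, $0\le p^{\mathrm{sd}}_{jt}\le\sum_{t'\in\mathcal T^{\mathrm{sdpc}}_{jt}}p^{\mathrm{sdpc}}_{jtt'}u^{\mathrm{sd}}_{jt'}$. $\mathcal X^{\mathrm{soc}}_t$ is the set of $(p_t,q_t,\mu_t,\omega_t)$ for which there exist $(c_t,s_t)$ with: for $j\in\mathcal J^{\mathrm{ac}}$, $p^{\mathrm{fr}}_{jt}=g_{i_jj}\mu_{jt}-g_jc_{jt}-b_js_{jt}$, $p^{\mathrm{to}}_{jt}=g_{i'_jj}\omega_{i'_jt}-g_jc_{jt}+b_js_{jt}$, $q^{\mathrm{fr}}_{jt}=-b_{i_jj}\mu_{jt}+b_jc_{jt}-g_js_{jt}$, $q^{\mathrm{to}}_{jt}=-b_{i'_jj}\omega_{i'_jt}+b_jc_{jt}+g_js_{jt}$, $c_{jt}^2+s_{jt}^2\le\mu_{jt}\omega_{i'_jt}$,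 $\omega_{i_jt}/(\tau^{\max}_j)^2\le\mu_{jt}\le\omega_{i_jt}/(\tau^{\min}_j)^2$; for $j\in\mathcal J^{\mathrm{sh}}$, $p^{\mathrm{sh}}_{jt}=g^{\mathrm{sh}}_j\mu^{\mathrm{sh}}_{jt}$, $q^{\mathrm{sh}}_{jt}=-b^{\mathrm{sh}}_j\mu^{\mathrm{sh}}_{jt}$, $u^{\mathrm{sh,min}}_j\omega_{i_jt}\le\mu^{\mathrm{sh}}_{jt}\le u^{\mathrm{sh,max}}_j\omega_{i_jt}$; $\omega_{it}\in[(v^{\min}_i)^2,(v^{\max}_i)^2]$ for $i\in\mathcal I$; and $p^{\mathrm{fr}}_{jt}+p^{\mathrm{to}}_{jt}=0$ and (DC) for $j\in\mathcal J^{\mathrm{dc}}$. *)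

(* Defs.v *)
From HB Require Import structures.
From mathcomp Require Import all_boot all_order all_algebra.
From mathcomp Require Import all_classical all_reals all_analysis.
Set Implicit Arguments.
Unset Strict Implicit.
Unset Printing Implicit Defensive.
Import Order.TTheory GRing.Theory Num.Theory.
Import numFieldNormedType.Exports.
Local Open Scope classical_set_scope.
Local Open Scope ring_scope.

Section Generic.
Context (R : realType).

Definition pospart (x : R) : R := Num.max x 0.

Definition norm2 (x y : R) : R := Num.sqrt (x ^+ 2 + y ^+ 2).

Definition binary (x : R) : Prop := x = 0 \/ x = 1.

Definition between (lo hi x : R) : Prop := lo <= x <= hi.

(* The maximum of finitely many reals: [sup] is attained on a finite nonempty
   set, and [sup set0 = 0] fixes the value of a maximum over no index. *)
Definition fin_max (I : finType) (A : {set I}) (F : I -> R) : R :=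
  sup [set F i | i in [set j | j \in A]].

(* Value of the problem "maximize [f] over [D]"; in the extended reals it is
   defined unconditionally, and [opt_value_max] shows that it is the maximum
   as soon as there is one. *)
Definition opt_value (X : Type) (D : set X) (f : X -> R) : \bar R :=
  ereal_sup [set (f x)%:E | x in D].

Lemma opt_value_max (X : Type) (D : set X) (f : X -> R) (x : X) :
  D x -> (forall y, D y -> f y <= f x) -> opt_value D f = (f x)%:E.
Proof.
move=> Dx fx; apply/eqP; rewrite eq_le; apply/andP; split.
  by apply: ge_ereal_sup => _ [y Dy <-]; rewrite lee_fin; exact: fx.
by apply: ereal_sup_ubound; exists x.
Qed.

Definition polyhedron (n : nat) (X : set 'rV[R]_n) : Prop :=
  exists (m : nat) (A : 'M[R]_(m, n)) (b : 'cV[R]_m),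
    X = [set x | forall k, (A *m x^T) k 0 <= b k 0].

(* [s] lists the breakpoints; taking [a], [b] arbitrarily far away, the two
   unbounded pieces are affine as well. *)
Definition piecewise_linear (f : R -> R) : Prop :=
  exists s : seq R, forall a b : R, a < b ->
    (forall x, x \in s -> ~~ (a < x < b)) ->
    exists m c : R, forall x, a <= x <= b -> f x = m * x + c.

Definition convex_fun (f : R -> R) : Prop := convex_function [set: R] f.

Definition concave_fun (f : R -> R) : Prop := convex_fun (fun x => - f x).

(* The value in the period before [t], which is [x0] before the first one. *)
Definition prev_val (n : nat) (x0 : R) (x : 'I_n -> R) (t : 'I_n) : R :=
  if t == 0 :> nat then x0 else x (ord_pred t).

Inductive requirement : Type :=
| ReqConst of R
| ReqSum of R
| ReqMax of R.

Definition requirement_ok (r : requirement) : Prop :=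
  match r with ReqConst _ => True | ReqSum c => 0 <= c | ReqMax c => 0 <= c end.

Definition req_value (I : finType) (r : requirement) (x : I -> R)
    (N : {set I}) : R :=
  match r with
  | ReqConst c => c
  | ReqSum c => c * \sum_(j in N) x j
  | ReqMax c => c * fin_max N x
  end.

End Generic.

(* The periods 1, ..., T are the elements of ['I_nT], shifted by one.
   Disjoint unions are sum types: a device is [inl] of a producer or [inr] of
   a consumer, a branch is [inl] of an AC branch or [inr] of a DC branch. *)
Record index_sets : Type := IndexSets {
  nT : nat;
  Jpr : finType;
  Jcs : finType;
  Bus : finType;
  Jac : finType;
  Jdc : finType;
  Jsh : finType;
  Res : finType;
  nK : nat
}.

Definition Jsd (S : index_sets) : finType := (Jpr S + Jcs S)%type.
Definition Jbr (S : index_sets) : finType := (Jac S + Jdc S)%type.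
Notation Per S := 'I_(nT S).

Definition reactive : finType := bool.
Notation up := (true : reactive).
Notation dn := (false : reactive).

Section Model.
Context (R : realType) (S : index_sets).

(* Coordinates of the points of the polyhedra: [X_u j] lives in the space of
   (u^on_1..u^on_T, u^su_1..u^su_T, u^sd_1..u^sd_T) and [X_p j t] in that of
   (u^on, p^tot, p^on, (p^res_r)_r). *)
Definition dim_u : nat := nT S + nT S + nT S.
Definition dim_p : nat := 1 + 1 + 1 + #|Res S|.

Record data : Type := Data {
  d : Per S -> R;
  bus_sd : Jsd S -> Bus S;
  bus_sh : Jsh S -> Bus S;
  bus_fr : Jbr S -> Bus S;
  bus_to : Jbr S -> Bus S;
  u_on0 : Jsd S -> bool;
  p_tot0 : Jsd S -> R;
  p_supc : Jsd S -> Per S -> Per S -> R;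
  p_sdpc : Jsd S -> Per S -> Per S -> R;
  X_u : Jsd S -> set 'rV[R]_dim_u;
  X_p : Jsd S -> Per S -> set 'rV[R]_dim_p;
  q_max : Jsd S -> Per S -> R;
  q_min : Jsd S -> Per S -> R;
  beta_max : Jsd S -> R;
  beta_min : Jsd S -> R;
  p_ru : Jsd S -> R;
  p_rd : Jsd S -> R;
  p_rusu : Jsd S -> R;
  p_rdsd : Jsd S -> R;
  (* [g_bus i j] is g_{ij} and [g_br j] is g_j; likewise for b *)
  g_bus : Bus S -> Jac S -> R;
  b_bus : Bus S -> Jac S -> R;
  g_br : Jac S -> R;
  b_br : Jac S -> R;
  g_sh : Jsh S -> R;
  b_sh : Jsh S -> R;
  v_min : Bus S -> R;
  v_max : Bus S -> R;
  phi_min : Jac S -> R;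
  phi_max : Jac S -> R;
  tau_min : Jac S -> R;
  tau_max : Jac S -> R;
  p_dc_max : Jdc S -> R;
  q_fr_min : Jdc S -> R;
  q_fr_max : Jdc S -> R;
  q_to_min : Jdc S -> R;
  q_to_max : Jdc S -> R;
  u_sh_min : Jsh S -> R;
  u_sh_max : Jsh S -> R;
  c_on : Jsd S -> Per S -> R;
  c_su : Jsd S -> R;
  c_sd : Jsd S -> R;
  c_dd : Jsd S -> Per S -> Per S -> R;
  c_e : R;
  W_min : Jsd S -> {set {set Per S}};
  W_max : Jsd S -> {set {set Per S}};
  e_min : Jsd S -> {set Per S} -> R;
  e_max : Jsd S -> {set Per S} -> R;
  C_pow : Jpr S -> Per S -> R -> R;
  R_pow : Jcs S -> Per S -> R -> R;
  (* [c_resP R'] and [c_resQ r] penalize shortfalls; [c_resp], [c_resq] are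
     unit costs of the reserves provided *)
  c_resp : Jsd S -> Per S -> Res S -> R;
  c_resP : {set Res S} -> R;
  c_resq : Jsd S -> Per S -> reactive -> R;
  c_resQ : reactive -> R;
  N_p : {set {set Jsd S}};
  N_q : {set {set Jsd S}};
  req_p : Per S -> {set Res S} -> {set Jsd S} -> requirement R;
  req_q : Per S -> reactive -> {set Jsd S} -> requirement R;
  c_s : R;
  c_p : R;
  c_q : R;
  s_max : Jac S -> R;
  s_max_ctg : Jac S -> R;
  j_ctg : 'I_(nK S) -> Jac S;
  F_ctg : 'I_(nK S) -> Jac S -> Bus S -> R
}.

Record data_ok (D : data) : Prop := DataOk {
  ok_K : (0 < nK S)%N;
  ok_d : forall t, 0 < d D t;
  ok_supc : forall j t t', 0 <= p_supc D j t t';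
  ok_sdpc : forall j t t', 0 <= p_sdpc D j t t';
  ok_Xu : forall j, polyhedron (X_u D j);
  ok_Xp : forall j t, polyhedron (X_p D j t);
  ok_v : forall i, 0 < v_min D i /\ 0 < v_max D i;
  ok_tau : forall j, 0 < tau_min D j /\ 0 < tau_max D j;
  ok_ush : forall j,
    u_sh_min D j \is a Num.int /\ u_sh_max D j \is a Num.int;
  ok_csu : forall j, 0 <= c_su D j;
  ok_csd : forall j, 0 <= c_sd D j;
  ok_cdd : forall j t t', 0 <= c_dd D j t t';
  ok_ce : 0 <= c_e D;
  ok_Cpow : forall j t,
    convex_fun (C_pow D j t) /\ piecewise_linear (C_pow D j t);
  ok_Rpow : forall j t,
    concave_fun (R_pow D j t) /\ piecewise_linear (R_pow D j t);
  ok_cresp : forall j t r, 0 <= c_resp D j t r;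
  ok_cresP : forall R', 0 <= c_resP D R';
  ok_cresq : forall j t r, 0 <= c_resq D j t r;
  ok_cresQ : forall r, 0 <= c_resQ D r;
  ok_reqp : forall t R' N, requirement_ok (req_p D t R' N);
  ok_reqq : forall t r N, requirement_ok (req_q D t r N);
  ok_cs : 0 <= c_s D;
  ok_cp : 0 <= c_p D;
  ok_cq : 0 <= c_q D
}.

(* p_{jt}, q_{jt} and u_{jt} for a device j; below, [per_p], [per_q], [per_u],
   [per_v] and [per_mu] are p_t, q_t, u_t, (v, Delta, theta, tau, phi)_t and
   mu_t. *)
Record dev_p : Type := DevP {
  p_tot : R; p_on : R; p_su : R; p_sd : R; p_res : Res S -> R }.
Record dev_q : Type := DevQ { q_tot : R; q_res : reactive -> R }.
Record dev_u : Type := DevU { u_on : R; u_su : R; u_sd : R }.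

Record per_p : Type := PerP {
  pdev : Jsd S -> dev_p; p_fr : Jbr S -> R; p_to : Jbr S -> R;
  p_sh : Jsh S -> R }.
Record per_q : Type := PerQ {
  qdev : Jsd S -> dev_q; q_fr : Jbr S -> R; q_to : Jbr S -> R;
  q_sh : Jsh S -> R }.
Record per_u : Type := PerU { udev : Jsd S -> dev_u; u_sh : Jsh S -> R }.

Record per_v : Type := PerV {
  vm : Bus S -> R; delta : Jac S -> R; theta : Bus S -> R;
  tau : Jac S -> R; phi : Jac S -> R }.

Record per_mu : Type := PerMu { mu : Jac S -> R; mu_sh : Jsh S -> R }.

Record solution : Type := Solution {
  sol_p : Per S -> per_p;
  sol_q : Per S -> per_q;
  sol_u : Per S -> per_u;
  sol_v : Per S -> per_v
}.

Context (D : data).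

Definition T_supc (j : Jsd S) (t : Per S) : {set Per S} :=
  [set t' : Per S | (t < t')%N && (0 < p_supc D j t t')].

Definition T_sdpc (j : Jsd S) (t : Per S) : {set Per S} :=
  [set t' : Per S | (t' <= t)%N && (0 < p_sdpc D j t t')].

Definition vec_u (uj : Per S -> dev_u) : 'rV[R]_dim_u :=
  row_mx (row_mx (\row_t u_on (uj t)) (\row_t u_su (uj t)))
         (\row_t u_sd (uj t)).

Definition vec_p (on : R) (p : dev_p) : 'rV[R]_dim_p :=
  row_mx (row_mx (row_mx on%:M (p_tot p)%:M) (p_on p)%:M)
         (\row_k p_res p (enum_val k)).

Definition cons_U (j : Jsd S) (uj : Per S -> dev_u) : Prop :=
  [/\ forall t, u_on (uj t) - prev_val (u_on0 D j)%:R (u_on \o uj) t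
                = u_su (uj t) - u_sd (uj t),
      forall t, u_su (uj t) + u_sd (uj t) <= 1,
      X_u D j (vec_u uj)
    & forall t, [/\ binary (u_on (uj t)), binary (u_su (uj t))
                  & binary (u_sd (uj t))] ].

Definition cons_P1 (p : dev_p) : Prop := p_tot p = p_on p + p_su p + p_sd p.

Definition su_power (j : Jsd S) (t : Per S) (su : Per S -> R) : R :=
  \sum_(t' in T_supc j t) p_supc D j t t' * su t'.

Definition sd_power (j : Jsd S) (t : Per S) (sd : Per S -> R) : R :=
  \sum_(t' in T_sdpc j t) p_sdpc D j t t' * sd t'.

Definition cons_P2 (j : Jsd S) (t : Per S) (p : dev_p) (su sd : Per S -> R)
    : Prop :=
  p_su p = su_power j t su /\ p_sd p = sd_power j t sd.

Definition cons_P3 (j : Jsd S) (t : Per S) (p : dev_p) (on : R) : Prop :=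
  X_p D j t (vec_p on p).

Definition cons_P4 (p : dev_p) : Prop :=
  [/\ 0 <= p_tot p, 0 <= p_on p & forall r, 0 <= p_res p r].

Definition sigma (j : Jsd S) (t : Per S) (on : R) (su sd : Per S -> R) : R :=
  on + \sum_(t' in T_supc j t) su t' + \sum_(t' in T_sdpc j t) sd t'.

(* The reactive reserves denoted a and b, in that order. *)
Definition res_ab (j : Jsd S) : reactive * reactive :=
  match j with inl _ => (up, dn) | inr _ => (dn, up) end.

Definition cons_Q (j : Jsd S) (t : Per S) (p : dev_p) (q : dev_q) (on : R)
    (su sd : Per S -> R) : Prop :=
  [/\ q_tot q <= q_max D j t * sigma j t on su sd + beta_max D j * p_tot p
                 - q_res q (res_ab j).1,
      q_min D j t * sigma j t on su sd + beta_min D j * p_tot p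
        + q_res q (res_ab j).2 <= q_tot q
    & forall r, 0 <= q_res q r].

Definition cons_R (j : Jsd S) (t : Per S) (pj : Per S -> dev_p)
    (uj : Per S -> dev_u) : Prop :=
  between
    (- (d D t * (p_rd D j * u_on (uj t) + p_rdsd D j * (1 - u_on (uj t)))))
    (d D t * (p_ru D j * (u_on (uj t) - u_su (uj t))
              + p_rusu D j * (u_su (uj t) - u_on (uj t) + 1)))
    (p_tot (pj t) - prev_val (p_tot0 D j) (p_tot \o pj) t).

Definition cons_S (j : Jsd S) (t : Per S) (on : R) (su sd : Per S -> R)
    : Prop :=
  on + \sum_(t' in T_supc j t) su t' <= 1 /\
  on + \sum_(t' in T_sdpc j t) sd t' <= 1.

Definition cons_F1 (p : per_p) (q : per_q) (x : per_v) (j : Jac S) : Prop :=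
  let i := bus_fr D (inl j) in
  let i' := bus_to D (inl j) in
  let v := vm x i in
  let v' := vm x i' in
  let ta := tau x j in
  let c := cos (delta x j) in
  let s := sin (delta x j) in
  [/\ delta x j = theta x i - theta x i' - phi x j,
      p_fr p (inl j) =
        v * (g_bus D i j * v / ta ^+ 2
             + v' / ta * (- g_br D j * c - b_br D j * s)),
      p_to p (inl j) =
        v' * (g_bus D i' j * v' + v / ta * (- g_br D j * c + b_br D j * s)),
      q_fr q (inl j) =
        v * (- b_bus D i j * v / ta ^+ 2
             + v' / ta * (b_br D j * c - g_br D j * s))
    & q_to q (inl j) =
        v' * (- b_bus D i' j * v' + v / ta * (b_br D j * c + g_br D j * s))].

Definition dc_balance (p : per_p) (j : Jdc S) : Prop :=
  p_fr p (inr j) + p_to p (inr j) = 0.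

Definition cons_F2 (p : per_p) (q : per_q) (u : per_u) (x : per_v) : Prop :=
  (forall j, dc_balance p j) /\
  (forall j : Jsh S,
    p_sh p j = g_sh D j * u_sh u j * vm x (bus_sh D j) ^+ 2 /\
    q_sh q j = - b_sh D j * u_sh u j * vm x (bus_sh D j) ^+ 2).

Definition cons_DC (p : per_p) (q : per_q) (j : Jdc S) : Prop :=
  [/\ between (- p_dc_max D j) (p_dc_max D j) (p_fr p (inr j)),
      between (- p_dc_max D j) (p_dc_max D j) (p_to p (inr j)),
      between (q_fr_min D j) (q_fr_max D j) (q_fr q (inr j))
    & between (q_to_min D j) (q_to_max D j) (q_to q (inr j))].

Definition cons_F3 (p : per_p) (q : per_q) (x : per_v) : Prop :=
  [/\ forall i, between (v_min D i) (v_max D i) (vm x i),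
      forall j, between (phi_min D j) (phi_max D j) (phi x j),
      forall j, between (tau_min D j) (tau_max D j) (tau x j)
    & forall j, cons_DC p q j].

Definition cons_F4 (u : per_u) : Prop :=
  forall j, between (u_sh_min D j) (u_sh_max D j) (u_sh u j) /\
            u_sh u j \is a Num.nat.

Definition C_uc (j : Jsd S) (uj : Per S -> dev_u) : R :=
  \sum_t (c_on D j t * u_on (uj t) + c_su D j * u_su (uj t)
          + c_sd D j * u_sd (uj t)
          - \sum_(t' : Per S | (t' < t)%N)
              c_dd D j t t' * pospart (u_su (uj t) + u_on (uj t') - 1)).

Definition C_e (j : Jsd S) (pj : Per S -> dev_p) : R :=
  let energy (W : {set Per S}) := \sum_(t in W) d D t * p_tot (pj t) in
  c_e D * (\sum_(W in W_min D j) pospart (e_min D j W - energy W)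
           + \sum_(W in W_max D j) pospart (- e_max D j W + energy W)).

Definition C_res (t : Per S) (p : per_p) (q : per_q) : R :=
  d D t *
  (\sum_(j : Jsd S) \sum_(r : Res S) c_resp D j t r * p_res (pdev p j) r
   + \sum_(R' : {set Res S}) c_resP D R' *
       \sum_(N in N_p D)
         pospart (req_value (req_p D t R' N) (fun j => p_tot (pdev p j)) N
                  - \sum_(r in R') \sum_(j in N) p_res (pdev p j) r)
   + \sum_(r : reactive)
       (\sum_(j : Jsd S) c_resq D j t r * q_res (qdev q j) r
        + c_resQ D r *
          \sum_(N in N_q D)
            pospart (req_value (req_q D t r N) (fun j => q_tot (qdev q j)) N
                     - \sum_(j in N) q_res (qdev q j) r))).

Definition C_ac (j : Jac S) (t : Per S) (p : per_p) (q : per_q) : R :=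
  c_s D * d D t *
  pospart (Num.max (norm2 (p_fr p (inl j)) (q_fr q (inl j)))
                   (norm2 (p_to p (inl j)) (q_to q (inl j)))
           - s_max D j).

(* Net injection at bus [i] of a quantity x in {p, q}, counting only the flows
   of the branches in [P]. *)
Definition net_inj (P : pred (Jbr S)) (i : Bus S) (xtot : Jsd S -> R)
    (xsh : Jsh S -> R) (xfr xto : Jbr S -> R) : R :=
  \sum_(j : Jpr S | bus_sd D (inl j) == i) xtot (inl j)
  - \sum_(j : Jcs S | bus_sd D (inr j) == i) xtot (inr j)
  - \sum_(j : Jsh S | bus_sh D j == i) xsh j
  - \sum_(j : Jbr S | P j && (bus_fr D j == i)) xfr j
  - \sum_(j : Jbr S | P j && (bus_to D j == i)) xto j.

Definition B_p (i : Bus S) (p : per_p) : R :=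
  net_inj predT i (fun j => p_tot (pdev p j)) (p_sh p) (p_fr p) (p_to p).

Definition B_q (i : Bus S) (q : per_q) : R :=
  net_inj predT i (fun j => q_tot (qdev q j)) (q_sh q) (q_fr q) (q_to q).

Definition C_bal (i : Bus S) (t : Per S) (p : per_p) (q : per_q) : R :=
  d D t * (c_p D * `|B_p i p| + c_q D * `|B_q i q|).

Definition is_dc (j : Jbr S) : bool := if j is inr _ then true else false.

Definition p_inj (i : Bus S) (p : per_p) : R :=
  net_inj is_dc i (fun j => p_tot (pdev p j)) (p_sh p) (p_fr p) (p_to p).

Definition f_ctg (k : 'I_(nK S)) (j : Jac S) (p : per_p) : R :=
  \sum_(i : Bus S) F_ctg D k j i *
    (p_inj i p - (#|Bus S|%:R)^-1 * \sum_(i' : Bus S) p_inj i' p).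

Definition C_ctgk (k : 'I_(nK S)) (t : Per S) (p : per_p) (q : per_q) : R :=
  c_s D * d D t *
  \sum_(j : Jac S | j != j_ctg D k)
    pospart (norm2 (f_ctg k j p)
                   (Num.max `|q_fr q (inl j)| `|q_to q (inl j)|)
             - s_max_ctg D j).

Definition C_ctg (t : Per S) (p : per_p) (q : per_q) : R :=
  (nK S)%:R^-1 * \sum_(k < nK S) C_ctgk k t p q
  + fin_max [set: 'I_(nK S)]%SET (fun k => C_ctgk k t p q).

Definition R_T (t : Per S) (p : per_p) (q : per_q) : R :=
  - C_res t p q - C_ctg t p q - \sum_(j : Jac S) C_ac j t p q
  - \sum_(i : Bus S) C_bal i t p q.

Definition R_J (j : Jsd S) (pj : Per S -> dev_p) (uj : Per S -> dev_u) : R :=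
  match j with
  | inl k => - C_uc j uj - C_e j pj - \sum_t C_pow D k t (p_tot (pj t))
  | inr k => - C_uc j uj - C_e j pj + \sum_t R_pow D k t (p_tot (pj t))
  end.

Definition feasible (x : solution) : Prop :=
  let pj j t := pdev (sol_p x t) j in
  let qj j t := qdev (sol_q x t) j in
  let uj j t := udev (sol_u x t) j in
  [/\ forall j, cons_U j (uj j),
      forall j t, [/\ cons_P1 (pj j t),
                      cons_P2 j t (pj j t) (u_su \o uj j) (u_sd \o uj j),
                      cons_P3 j t (pj j t) (u_on (uj j t))
                    & cons_P4 (pj j t)],
      forall j t, cons_Q j t (pj j t) (qj j t) (u_on (uj j t))
                         (u_su \o uj j) (u_sd \o uj j),
      forall j t, cons_R j t (pj j) (uj j)
    & forall t, [/\ forall j, cons_F1 (sol_p x t) (sol_q x t) (sol_v x t) j,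
                    cons_F2 (sol_p x t) (sol_q x t) (sol_u x t) (sol_v x t),
                    cons_F3 (sol_p x t) (sol_q x t) (sol_v x t)
                  & cons_F4 (sol_u x t)] ].

Definition objective (x : solution) : R :=
  \sum_t R_T t (sol_p x t) (sol_q x t)
  + \sum_(j : Jsd S) R_J j (fun t => pdev (sol_p x t) j)
                           (fun t => udev (sol_u x t) j).

Definition Z_star : \bar R := opt_value feasible objective.

Record standing_assumption : Prop := StandingAssumption {
  sa_downtime : forall j (t : Per S),
    \sum_(t' : Per S | (t' < t)%N) c_dd D j t t' <= c_su D j;
  sa_S : forall j (uj : Per S -> dev_u), cons_U j uj ->
    forall t, cons_S j t (u_on (uj t)) (u_su \o uj) (u_sd \o uj);
  sa_Xp : forall j t, [/\ closed (X_p D j t), convex_set (X_p D j t),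
                          bounded_set (X_p D j t) & polyhedron (X_p D j t)];
  sa_feasible : exists x, feasible x;
  sa_Z : (0 <= Z_star)%E
}.

Definition Y_uc (j : Jsd S) (t : Per S) : set (dev_p * dev_q * R) :=
  [set y | let: (p, q, on) := y in
    0 <= on /\
    exists su sd : Per S -> R,
      (forall t', between 0 1 (su t') /\ between 0 1 (sd t')) /\
      [/\ cons_P1 p, cons_P3 j t p on, cons_P4 p,
          cons_Q j t p q on su sd & cons_S j t on su sd] /\
      between 0 (su_power j t su) (p_su p) /\
      between 0 (sd_power j t sd) (p_sd p)].

(* No datum of this set depends on the period. *)
Definition X_soc : set (per_p * per_q * per_mu * (Bus S -> R)) :=
  [set y | let: (p, q, m, om) := y in
    exists c s : Jac S -> R,
    [/\ forall j : Jac S,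
          let i := bus_fr D (inl j) in
          let i' := bus_to D (inl j) in
          [/\ p_fr p (inl j) =
                g_bus D i j * mu m j - g_br D j * c j - b_br D j * s j,
              p_to p (inl j) =
                g_bus D i' j * om i' - g_br D j * c j + b_br D j * s j,
              q_fr q (inl j) =
                - b_bus D i j * mu m j + b_br D j * c j - g_br D j * s j
            & q_to q (inl j) =
                - b_bus D i' j * om i' + b_br D j * c j + g_br D j * s j]
          /\ c j ^+ 2 + s j ^+ 2 <= mu m j * om i'
          /\ between (om i / tau_max D j ^+ 2) (om i / tau_min D j ^+ 2)
                     (mu m j),
        forall j : Jsh S,
          let i := bus_sh D j in
          [/\ p_sh p j = g_sh D j * mu_sh m j,
              q_sh q j = - b_sh D j * mu_sh m j
            & between (u_sh_min D j * om i) (u_sh_max D j * om i) (mu_sh m j)],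
        forall i, between (v_min D i ^+ 2) (v_max D i ^+ 2) (om i)
      & forall j : Jdc S, dc_balance p j /\ cons_DC p q j] ].

Definition C_UB (t : Per S) (p : per_p) (q : per_q) (u : per_u) : R :=
  \sum_(j : Jcs S) R_pow D j t (p_tot (pdev p (inr j)))
  - \sum_(j : Jpr S) C_pow D j t (p_tot (pdev p (inl j)))
  - \sum_(j : Jac S) C_ac j t p q
  - \sum_(i : Bus S) C_bal i t p q
  - \sum_(j : Jsd S) c_on D j t * u_on (udev u j)
  - C_res t p q.

Definition Z_UB_t (t : Per S) : \bar R :=
  opt_value
    [set y : per_p * per_q * per_u * per_mu * (Bus S -> R) |
      let: (p, q, u, m, om) := y in
      X_soc (p, q, m, om) /\
      forall j, Y_uc j t (pdev p j, qdev q j, u_on (udev u j))]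
    (fun y => let: (p, q, u, _, _) := y in C_UB t p q u).

Definition Z_UB : \bar R := (\sum_(t < nT S) Z_UB_t t)%E.

End Model.

(* Main.v *)
Require Import Defs.
From mathcomp Require Import all_boot all_order all_algebra.
From mathcomp Require Import all_classical all_reals all_analysis.
From mathcomp Require Import ring lra.

(** Every feasible point of SCUC-ACOPF, restricted to one period, is feasible
    for the relaxation of that period: take [omega_i = v_i^2],
    [mu_j = v_i^2 / tau_j^2], [mu_sh_j = u_sh_j * v_i^2] and
    [(c_j, s_j) = (v_i * v_i' / tau_j) * (cos delta_j, sin delta_j)].  The terms
    of the objective missing from [C_UB] are nonnegative costs; in particular,
    as [[su + on - 1]^+ <= su] for binary values, the startup cost pays for all
    the downtime-dependent discounts. *)

Set Implicit Arguments.
Unset Strict Implicit.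
Unset Printing Implicit Defensive.
Import Order.TTheory GRing.Theory Num.Theory.
Local Open Scope ring_scope.

Section Relaxation.
Context (R : realType).

Lemma pospart_ge0 (x : R) : 0 <= pospart x.
Proof. by rewrite /pospart le_max lexx orbT. Qed.

(** If the values have no supremum, in particular over no index, [sup] defaults to 0; otherwise some
    value exists, and it is a nonnegative lower estimate of the supremum. *)
Lemma fin_max_ge0 (I : finType) (A : {set I}) (F : I -> R) :
  (forall i, 0 <= F i) -> 0 <= fin_max A F.
Proof.
move=> F0; rewrite /fin_max; set E := (X in sup X).
have [Esup|/sup_out -> //] := pselect (has_sup E).
have [[_ [i Ai _]] Eub] := Esup.
by apply: le_trans (F0 i) (ub_le_sup Eub _); exists i.
Qed.

Lemma binary_between01 (x : R) : binary x -> 0 <= x <= 1.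
Proof. by case=> ->; rewrite ?lexx ler01. Qed.

Context (S : index_sets) (D : data R S) (HD : data_ok D).

Lemma C_ctg_ge0 t p q : 0 <= C_ctg D t p q.
Proof.
have Ck k : 0 <= C_ctgk D k t p q.
  rewrite /C_ctgk mulr_ge0 ?sumr_ge0 // => [|j _]; last exact: pospart_ge0.
  by rewrite mulr_ge0 ?ok_cs ?ltW ?ok_d.
by rewrite /C_ctg addr_ge0 ?fin_max_ge0 // mulr_ge0 ?invr_ge0 ?ler0n ?sumr_ge0.
Qed.

Lemma C_e_ge0 j pj : 0 <= C_e D j pj.
Proof.
by rewrite /C_e mulr_ge0 ?(ok_ce HD) // addr_ge0 // sumr_ge0 // => W _;
   exact: pospart_ge0.
Qed.

Lemma su_power_ge0 j t su : (forall t', 0 <= su t') -> 0 <= su_power D j t su.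
Proof. by move=> su0; apply: sumr_ge0 => t' _; rewrite mulr_ge0 ?ok_supc. Qed.

Lemma sd_power_ge0 j t sd : (forall t', 0 <= sd t') -> 0 <= sd_power D j t sd.
Proof. by move=> sd0; apply: sumr_ge0 => t' _; rewrite mulr_ge0 ?ok_sdpc. Qed.

Context (HA : standing_assumption D).

Lemma C_uc_ge_on j uj : cons_U D j uj ->
  \sum_t c_on D j t * u_on (uj t) <= C_uc D j uj.
Proof.
case=> _ _ _ Ub; apply: ler_sum => t _.
have [/binary_between01 on01 /binary_between01/andP[su0 su1]
  /binary_between01/andP[sd0 _]] := Ub t.
have dd : \sum_(t' : Per S | (t' < t)%N)
    c_dd D j t t' * pospart (u_su (uj t) + u_on (uj t') - 1)
    <= c_su D j * u_su (uj t).
  (* Scaling the cost assumption by [u_su >= 0] reduces the claim to one discount at a time, where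
     it amounts to [u_on <= 1] in the earlier period. *)
  apply: le_trans (ler_wpM2r su0 (sa_downtime HA j t)).
  rewrite mulr_suml; apply: ler_sum => t' _.
  apply: ler_wpM2l; first exact: ok_cdd.
  rewrite /pospart ge_max su0 andbT.
  have [/binary_between01/andP[_ on1] _ _] := Ub t'; lra.
have sd_cost : 0 <= c_sd D j * u_sd (uj t) by rewrite mulr_ge0 ?ok_csd.
lra.
Qed.

Section FeasiblePoint.
Context (x : solution R S) (Fx : feasible D x).

Definition soc_mu t : per_mu R S :=
  PerMu (fun j => vm (sol_v x t) (bus_fr D (inl j)) ^+ 2
                  / tau (sol_v x t) j ^+ 2)
        (fun j => u_sh (sol_u x t) j * vm (sol_v x t) (bus_sh D j) ^+ 2).

Definition soc_omega t (i : Bus S) : R := vm (sol_v x t) i ^+ 2.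

Lemma feasible_X_soc t :
  X_soc D (sol_p x t, sol_q x t, soc_mu t, soc_omega t).
Proof.
have [_ _ _ _ /(_ t)[F1 [F2dc F2sh] [F3v _ F3tau F3dc] F4]] := Fx.
pose w j := vm (sol_v x t) (bus_fr D (inl j))
            * vm (sol_v x t) (bus_to D (inl j)) / tau (sol_v x t) j.
have v_ge0 i : 0 <= vm (sol_v x t) i.
  have /andP[vmin _] := F3v i.
  by apply: le_trans vmin; have [/ltW] := ok_v HD i.
exists (fun j => w j * cos (delta (sol_v x t) j)).
exists (fun j => w j * sin (delta (sol_v x t) j)).
split => [j|j|i|j] /=.
- have [_ pfr pto qfr qto] := F1 j.
  have /andP[tau_lo tau_hi] := F3tau j.
  have [tmin0 tmax0] := ok_tau HD j.
  have tau0 : 0 < tau (sol_v x t) j by exact: lt_le_trans tau_lo.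
  have tauN0 : tau (sol_v x t) j != 0 by rewrite gt_eqF.
  rewrite /soc_omega /w; split; first split.
  + by rewrite pfr; field.
  + by rewrite pto; field.
  + by rewrite qfr; field.
  + by rewrite qto; field.
  split.
    (* The conic constraint holds with equality, by [cos^2 + sin^2 = 1]. *)
    by rewrite !exprMn -mulrDr cos2Dsin2 mulr1 exprVn mulrAC.
  (* Dividing by a positive square reverses order, so the largest tap ratio gives the lower bound on
     [mu]. *)
  by apply/andP; split; apply: ler_wpM2l; rewrite ?sqr_ge0 // lef_pV2
    ?posrE ?exprn_gt0 // lerXn2r ?nnegrE // ltW.
- have [psh qsh] := F2sh j.
  have [/andP[ulo uhi] _] := F4 j.
  rewrite /soc_omega; split; first by rewrite psh -mulrA.
    by rewrite qsh -mulrA.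
  by apply/andP; split; apply: ler_wpM2r; rewrite ?sqr_ge0.
- have /andP[vlo vhi] := F3v i.
  have [/ltW vmin0 /ltW vmax0] := ok_v HD i.
  by apply/andP; split; rewrite /soc_omega lerXn2r ?nnegrE.
- by split; [exact: F2dc | exact: F3dc].
Qed.

(** The witnesses are the whole startup and shutdown trajectories of the device, since the power in
    one period may depend on switching in others. The standing assumption supplies (S). *)
Lemma feasible_Y_uc t j :
  Y_uc D j t (pdev (sol_p x t) j, qdev (sol_q x t) j,
              u_on (udev (sol_u x t) j)).
Proof.
have [FU FP FQ _ _] := Fx.
have [_ _ _ Ub] := FU j.
have [P1 [Psu Psd] P3 P4] := FP j t.
have su01 t' : between 0 1 (u_su (udev (sol_u x t') j)).
  by have [_ + _] := Ub t'; exact: binary_between01.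
have sd01 t' : between 0 1 (u_sd (udev (sol_u x t') j)).
  by have [_ _] := Ub t'; exact: binary_between01.
split; first by have [/binary_between01/andP[]] := Ub t.
exists (fun t' => u_su (udev (sol_u x t') j)).
exists (fun t' => u_sd (udev (sol_u x t') j)).
split; first by [].
split; first by split => //; exact: (sa_S HA (FU j)).
(* By (P2) the upper bounds are equalities, so only nonnegativity of the two powers remains. *)
split; rewrite /between ?Psu ?Psd lexx andbT.
  by apply: su_power_ge0 => t' /=; have /andP[] := su01 t'.
by apply: sd_power_ge0 => t' /=; have /andP[] := sd01 t'.
Qed.

Lemma C_UB_le_Z_UB_t t :
  ((C_UB D t (sol_p x t) (sol_q x t) (sol_u x t))%:E <= Z_UB_t D t)%E.
Proof.
apply: ereal_sup_ubound.
exists (sol_p x t, sol_q x t, sol_u x t, soc_mu t, soc_omega t) => //.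
by split; [exact: feasible_X_soc | exact: feasible_Y_uc].
Qed.

Lemma objective_le_C_UB :
  objective D x <= \sum_t C_UB D t (sol_p x t) (sol_q x t) (sol_u x t).
Proof.
have [FU _ _ _ _] := Fx.
(* Signed market value of a device in one period, treating producers and consumers uniformly until
   the sum is split by type. *)
pose pow (j : Jsd S) t : R := match j with
  | inl k => - C_pow D k t (p_tot (pdev (sol_p x t) (inl k)))
  | inr k => R_pow D k t (p_tot (pdev (sol_p x t) (inr k)))
  end.
have RJ j : R_J D j (fun t => pdev (sol_p x t) j) (fun t => udev (sol_u x t) j)
    <= \sum_t (pow j t - c_on D j t * u_on (udev (sol_u x t) j)).
  have := C_uc_ge_on (FU j).
  have := C_e_ge0 j (fun t => pdev (sol_p x t) j).
  by rewrite sumrB; case: j => k /=; rewrite ?sumrN; lra.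
apply: le_trans (lerD (lexx _) (ler_sum _ (fun j _ => RJ j))) _.
(* With device terms regrouped by period, the two sides differ in each period exactly by [C_ctg]. *)
rewrite exchange_big /= -big_split /=; apply: ler_sum => t _.
rewrite sumrB [\sum_i pow i t]big_sumType /= sumrN /R_T /C_UB.
by have := C_ctg_ge0 t (sol_p x t) (sol_q x t); lra.
Qed.

End FeasiblePoint.
End Relaxation.

Theorem theorem4 (R : realType) (S : index_sets) (D : data R S)
    (HD : data_ok D) (HA : standing_assumption D) :
  (Z_star D <= Z_UB D)%E.
Proof.
(* Both values are suprema, so bounding each feasible point suffices and no maximizer has to be
   exhibited. *)
apply: ge_ereal_sup => _ [x Fx <-].
apply: le_trans (_ : (\sum_t (C_UB D t (sol_p x t) (sol_q x t)
  (sol_u x t))%:E <= _)%E); last first.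
  by apply: lee_sum => t _; exact: C_UB_le_Z_UB_t.
by rewrite sumEFin lee_fin; exact: objective_le_C_UB.
Qed.
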